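(* Let $G=(V,E)$ be a finite graph with vertices $v_1,\ldots,v_n$ and let $\alpha$ be its independence number. To each $v_i$, $i=1,\ldots,n$, associate a Bernoulli $0/1$ random variable $B_i$ such that $\mathbb{P}[B_i=1]=\frac12$. Suppose that each random variable $B_i$, $i=1,\ldots,n$, is independent of the set $\{B_j: j\ne i,\ (v_i,v_j)\notin E\}$. If $t$ is a real number such that $\frac n2<t<n$, then $$\mathbb{P}\left[\sum_{i=1}^nB_i\ge t\right]\le 2^{\,n-\alpha}H(n,1/2,t),$$ where $H(n,p,t)=p^t(1-p)^{n-t}\left(\frac{n-t}{t}\right)^t\left(\frac{n}{n-t}\right)^n$.
   Context: The independence number of a finite graph is the cardinality of the largest set of vertices no two of which are adjacent. ''$B_i$ is independent of a set of random variables'' means that $B_i$ is independent of the $\sigma$-algebra generated jointly by that set. *)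

(* Defs.v *)
From HB Require Import structures.
From mathcomp Require Import all_boot all_order all_algebra.
From mathcomp Require Import all_classical all_reals all_analysis.

Set Implicit Arguments.
Unset Strict Implicit.
Unset Printing Implicit Defensive.

Import Order.TTheory GRing.Theory Num.Theory.
Import numFieldNormedType.Exports.

Local Open Scope classical_set_scope.
Local Open Scope ring_scope.

Definition independent_set (V : finType) (e : rel V) (S : {set V}) : bool :=
  [forall x in S, forall y in S, (x != y) ==> ~~ e x y].

Definition independence_number (V : finType) (e : rel V) : nat :=
  \max_(S : {set V} | independent_set e S) #|S|.

(* The law of X is the image of the Bernoulli law on bool under
   false |-> 0, true |-> 1; hence X takes its values in {0, 1} almost surely. *)
Definition bernoulli_rv (d : measure_display) (T : measurableType d)
    (R : realType) (P : probability T R) (p : R) (X : {RV P >-> R}) : Prop :=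
  forall A : set R, measurable A ->
    distribution P X A = bernoulli_prob p [set b : bool | A (b%:R)].

Definition sigma_generated (d d' : measure_display) (T : measurableType d)
    (T' : measurableType d') (I : Type) (X : I -> T -> T') (J : set I) :
    set (set T) :=
  <<s \bigcup_(j in J) preimage_set_system setT (X j) measurable >>.

Definition independent_of_family (d d' : measure_display)
    (T : measurableType d) (T' : measurableType d') (R : realType)
    (P : probability T R) (I : Type) (X : {RV P >-> T'})
    (Y : I -> {RV P >-> T'}) (J : set I) : Prop :=
  forall (A : set T') (C : set T),
    measurable A -> sigma_generated (fun j => Y j : T -> T') J C ->
    P ((X @^-1` A) `&` C) = (P (X @^-1` A) * P C)%E.

Definition hoeffding_H (R : realType) (n : nat) (p t : R) : R :=
  p `^ t * (1 - p) `^ (n%:R - t) * ((n%:R - t) / t) `^ t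
  * (n%:R / (n%:R - t)) ^+ n.

(* Main.v *)
Require Import Defs.
From mathcomp Require Import all_boot all_order all_algebra.
From mathcomp Require Import all_classical all_reals all_analysis.
From mathcomp Require Import ring lra.

(** Let [S] be a largest independent set of vertices.  Each [B i] with [i] in
    [S] is independent of the other [B j], [j] in [S], jointly; peeling off one
    variable at a time, the whole subfamily indexed by [S] is mutually
    independent ([prob_bigsetI_independent]), hence uniform on [{0, 1}^S].
    So each point [x] of the cube [{0, 1}^n] satisfies
    [P (B = x) <= P (B = x on S) = 2 ^- #|S|] ([prob_cube_point_le]),
    whatever the dependencies outside of [S].

    Almost surely, the sum of the [B i] is at least [t] only if [B] equals one
    of the points of the cube having at least [t] ones, so the probability is
    at most [2 ^- #|S|] times the number of such points.  This number is bounded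
    by the exponential moment method ([card_heavy_points_le]): for [1 <= s],
    weighting a point with [k] ones by [s ^ k] gives total weight [(1 + s) ^ n]
    to the cube, while a point with at least [t] ones has weight at least
    [s ^ t].  The optimal choice [s = t / (n - t)], which is at least [1]
    because [n / 2 < t], turns the bound into [2 ^ n * H(n, 1/2, t)]. *)

Set Implicit Arguments.
Unset Strict Implicit.
Unset Printing Implicit Defensive.

Import Order.TTheory GRing.Theory Num.Theory.
Import numFieldNormedType.Exports.

Local Open Scope classical_set_scope.
Local Open Scope ring_scope.

Lemma smallest_sigma_algebra_bigsetI (T : pointedType) (I : Type)
    (G : set (set T)) (s : seq I) (Q : pred I)
    (F : I -> set T) :
  (forall i, Q i -> <<s G >> (F i)) ->
  <<s G >> (\big[setI/setT]_(i <- s | Q i) F i).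
Proof.
move=> GF.
exact: (@bigsetI_measurable _ (g_sigma_algebraType G) _ s Q F GF).
Qed.

(** Peel off the head of [s]: the events of the tail generate a part of the
    sigma-algebra that the head variable is independent of, so one application
    of the hypothesis splits off its factor. *)
Lemma prob_bigsetI_independent (R : realType) (d d' : measure_display)
    (T : measurableType d) (T' : measurableType d') (P : probability T R)
    (I : eqType) (X : I -> {RV P >-> T'}) (J : I -> set I) (s : seq I)
    (A : I -> set T') :
  (forall i, independent_of_family (X i) X (J i)) ->
  uniq s -> {in s &, forall i j, j != i -> J i j} ->
  (forall i, measurable (A i)) ->
  P (\big[setI/setT]_(i <- s) (X i @^-1` A i)) =
  (\prod_(i <- s) P (X i @^-1` A i))%E.
Proof.
move=> indepX + + mA; elim: s => [_ _|i s IHs /= /andP[iNs us] sJ].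
  by rewrite !big_nil probability_setT.
rewrite !big_cons -IHs//; last first.
  by move=> j k js ks; apply: sJ; rewrite inE ?js ?ks orbT.
apply: indepX => //; rewrite big_seq.
apply: smallest_sigma_algebra_bigsetI => j js.
apply: sub_sigma_algebra; exists j; last by exists (A j); rewrite ?setTI.
apply: sJ; rewrite ?inE ?eqxx ?js ?orbT//.
by apply: contraNneq iNs => <-.
Qed.

Lemma prob_bernoulli_half_eq (R : realType) (d : measure_display)
    (T : measurableType d) (P : probability T R) (X : {RV P >-> R}) (b : bool) :
  bernoulli_rv 2^-1 X -> P (X @^-1` [set b%:R]) = (2^-1)%:E.
Proof.
move=> /(_ [set b%:R] (measurable_set1 _)).
rewrite /distribution /pushforward => ->.
rewrite bernoulli_probE; last by apply/andP; split; lra.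
rewrite !diracE -EFinM -EFinM -EFinD /unstable.onem; congr _%:E.
have -> : (true \in [set b0 : bool | [set b%:R : R] b0%:R]) = b.
  apply/idP/idP; rewrite inE /=; case: b => //= /eqP.
  by rewrite oner_eq0.
have -> : (false \in [set b0 : bool | [set b%:R : R] b0%:R]) = ~~ b.
  apply/idP/idP; rewrite inE /=; case: b => //= /esym/eqP.
  by rewrite oner_eq0.
by case: b => /=; lra.
Qed.

Lemma prob_bernoulli_nonbinary (R : realType) (d : measure_display)
    (T : measurableType d) (P : probability T R) (p : R) (X : {RV P >-> R}) :
  bernoulli_rv p X -> P (X @^-1` (~` [set 0; 1])) = 0%E.
Proof.
have m01 : measurable (~` [set 0; 1] : set R).
  by apply: measurableC; apply: measurableU; exact: measurable_set1.
move=> /(_ _ m01); rewrite /distribution /pushforward => ->.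
rewrite (_ : [set b : bool | _] = set0) ?measure0//.
by apply/seteqP; split => // -[] /= []; [right|left].
Qed.

(** Forgetting the coordinates outside of an independent set [S] leaves an
    event on mutually independent fair bits. *)
Lemma prob_cube_point_le (R : realType) (d : measure_display)
    (T : measurableType d) (P : probability T R) (V : finType) (e : rel V)
    (B : V -> {RV P >-> R}) (S : {set V}) (x : {ffun V -> bool}) :
  (forall i, bernoulli_rv 2^-1 (B i)) ->
  (forall i, independent_of_family (B i) B [set j | j != i /\ ~~ e i j]) ->
  independent_set e S ->
  (P (\big[setI/setT]_i (B i @^-1` [set (x i)%:R])) <= (2 ^- #|S|)%:E)%E.
Proof.
move=> Bber Bindep Sindep.
have mB (i : V) : measurable (B i @^-1` [set (x i)%:R]).
  by rewrite -[X in measurable X]setTI; exact: measurable_funPT.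
have <- : P (\big[setI/setT]_(i <- enum S) (B i @^-1` [set (x i)%:R])) =
    (2 ^- #|S|)%:E.
  rewrite (@prob_bigsetI_independent _ _ _ _ _ P _ B _ (enum S)
      (fun i => [set (x i)%:R : R]) Bindep)//.
  - under eq_bigr do rewrite (prob_bernoulli_half_eq _ (Bber _)).
    by rewrite prodEFin big_const_seq count_predT -cardE iter_mulr_1 exprVn.
  - exact: enum_uniq.
  - move=> i j; rewrite !mem_enum => iS jS ji; split => //.
    move/forall_inP: Sindep => /(_ i iS)/forall_inP/(_ j jS).
    by rewrite eq_sym ji.
apply: le_measure; rewrite ?inE; try exact: bigsetI_measurable.
rewrite -!bigcap_seq => w /= Bw i _; apply: Bw => /=.
by rewrite mem_index_enum.
Qed.

(** Weight each point of the cube by [s] to the number of its ones: the weights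
    add up to the right-hand side, by expanding the product over [V] of
    [s + 1], and each point counted on the left weighs at least [s `^ t]. *)
Lemma card_heavy_points_le (R : realType) (V : finType) (s t : R) :
  1 <= s ->
  #|[set x : {ffun V -> bool} | t <= \sum_i (x i)%:R]%SET|%:R * s `^ t
    <= (1 + s) ^+ #|V|.
Proof.
move=> s1; have s0 : 0 <= s by lra.
have -> : (1 + s) ^+ #|V| =
    \sum_(x : {ffun V -> bool}) \prod_i (if x i then s else 1).
  rewrite -(bigA_distr_bigA (fun (_ : V) b => if b then s else 1 : R)) /=.
  under eq_bigr do rewrite big_bool /= addrC.
  by rewrite prodr_const.
rewrite mulr_natl -sumr_const big_mkcond /=; apply: ler_sum => x _.
rewrite inE; case: ifPn => [tx|_]; last first.
  by apply: prodr_ge0 => i _; case: ifP.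
have -> : \prod_i (if x i then s else 1) = s `^ (\sum_i (x i)%:R).
  rewrite -natr_sum powR_mulrn// -big_mkcond /= prodr_const.
  congr (_ ^+ _); rewrite -sum1_card [LHS]big_mkcond /=.
  by apply: eq_bigr => i _; rewrite -topredE /=; case: (x i).
exact: ler_powR.
Qed.

Lemma measure_bigsetU_le (d : measure_display) (T : measurableType d)
    (R : realType) (mu : {measure set T -> \bar R}) (I : Type) (s : seq I)
    (Q : pred I) (F : I -> set T) :
  (forall i, Q i -> measurable (F i)) ->
  (mu (\big[setU/set0]_(i <- s | Q i) F i)
     <= \sum_(i <- s | Q i) mu (F i))%E.
Proof.
move=> mF; elim: s => [|i s IHs]; first by rewrite !big_nil measure0.
rewrite !big_cons; case: ifPn => // Qi.
apply: le_trans (measureU2 _ _ _) _; first exact: mF.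
  exact: bigsetU_measurable.
exact: leeD.
Qed.

Lemma independence_number_attained (V : finType) (e : rel V) :
  exists2 S : {set V}, independent_set e S & independence_number e = #|S|.
Proof.
have : (0 < #|[pred S : {set V} | independent_set e S]|)%N.
  apply/card_gt0P; exists finset.set0; rewrite inE.
  by apply/forall_inP => i; rewrite inE.
by move=> /(eq_bigmax_cond (fun S : {set V} => #|S|))[S iS eS]; exists S.
Qed.

(** The right-hand side is the exponential moment bound
    [(1 + s) ^+ n / s `^ t] at its minimum over [s], [s = t / (n - t)]. *)
Lemma hoeffding_H_half (R : realType) (n : nat) (t : R) :
  0 < t -> t < n%:R ->
  2 ^+ n * hoeffding_H n 2^-1 t =
  (1 + t / (n%:R - t)) ^+ n / (t / (n%:R - t)) `^ t.
Proof.
move=> t0 tn; rewrite /hoeffding_H.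
have nt0 : 0 < n%:R - t by rewrite subr_gt0.
have -> : (1 - 2^-1 : R) = 2^-1 by lra.
rewrite -powRD; last by apply/implyP => _; apply/eqP; lra.
rewrite addrC subrK powR_mulrn; last by lra.
rewrite !mulrA -exprMn divff// expr1n mul1r mulrC.
congr (_ ^+ _ * _); first by field; rewrite gt_eqF.
have r0 : 0 <= t / (n%:R - t) by rewrite divr_ge0// ltW.
by rewrite -powRN -[X in X `^ t]invf_div -(powR_inv1 r0) -powRrM mulN1r.
Qed.

Theorem theorem1p14 (R : realType) (d : measure_display)
    (Omega : measurableType d) (P : probability Omega R)
    (n : nat) (e : rel 'I_n) (B : 'I_n -> {RV P >-> R}) (t : R)
    (e_sym : symmetric e) (e_irr : irreflexive e)
    (B_bernoulli : forall i, bernoulli_rv 2^-1 (B i))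
    (B_indep : forall i,
       independent_of_family (B i) B [set j | j != i /\ ~~ e i j])
    (t_gt : n%:R / 2 < t) (t_lt : t < n%:R) :
  (P [set w | (t <= \sum_(i < n) B i w)%R]
     <= (2 ^+ (n - independence_number e) * hoeffding_H n 2^-1 t)%R%:E)%E.
Proof.
have [S Sindep ->] := independence_number_attained e.
have n0 : 0 <= n%:R :> R by [].
have nt0 : 0 < n%:R - t by rewrite subr_gt0.
have t0 : 0 < t by lra.
set heavy := [set x : {ffun 'I_n -> bool} | t <= \sum_i (x i)%:R]%SET.
pose point (x : {ffun 'I_n -> bool}) :=
  \big[setI/setT]_i (B i @^-1` [set (x i)%:R]).
pose nonbinary := \big[setU/set0]_i (B i @^-1` (~` [set 0; 1])).
have mB (A : set R) i : measurable A -> measurable (B i @^-1` A).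
  by move=> mA; rewrite -[X in measurable X]setTI; exact: measurable_funPT.
have m01 : measurable (~` [set 0; 1] : set R).
  by apply: measurableC; apply: measurableU; exact: measurable_set1.
have mpoint x : measurable (point x).
  by apply: bigsetI_measurable => i _; apply: mB.
have mheavy : measurable (\big[setU/set0]_(x in heavy) point x).
  exact: bigsetU_measurable.
have mnonbinary : measurable nonbinary.
  by apply: bigsetU_measurable => i _; exact: mB.
have P_nonbinary : P nonbinary = 0%E.
  apply/eqP; rewrite -measure_le0.
  apply: le_trans (measure_bigsetU_le _ _ (fun i _ => mB _ i m01)) _.
  by rewrite big1// => i _; exact: prob_bernoulli_nonbinary (B_bernoulli i).
(* The [B i] are binary only almost surely, hence the null set. *)
have cover : [set w | t <= \sum_(i < n) B i w] `<=`
    \big[setU/set0]_(x in heavy) point x `|` nonbinary.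
  move=> w /= tw; have [|wbin] := pselect (nonbinary w); first by right.
  left; rewrite -bigcup_pred.
  pose x := [ffun i => B i w == 1].
  have xw i : B i w = (x i)%:R.
    rewrite ffunE; case: eqP => [//|w1]; apply: contrapT => w0.
    apply: wbin; rewrite /nonbinary -bigcup_seq.
    by exists i; rewrite /= ?mem_index_enum// => -[].
  exists x => /=.
    by rewrite inE; under eq_bigr do rewrite -xw.
  by rewrite /point -bigcap_seq => i _ /=.
have mtail : measurable [set w | t <= \sum_(i < n) B i w].
  rewrite (_ : mkset _ = (fun w => \sum_(i < n) B i w) @^-1` `[t, +oo[).
    rewrite -[X in measurable X]setTI; apply: (measurable_sum _ _) => //.
  by apply/seteqP; split => w /=; rewrite in_itv/= andbT.
apply: (@le_trans _ _ (P (\big[setU/set0]_(x in heavy) point x))).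
  rewrite -(measureU0 mheavy mnonbinary P_nonbinary).
  by apply: le_measure; rewrite ?inE//; exact: measurableU.
apply: le_trans (measure_bigsetU_le _ _ (fun x _ => mpoint x)) _.
apply: (@le_trans _ _ (\sum_(x in heavy) (2 ^- #|S|)%:E)%E).
  by apply: lee_sum => x _; exact: prob_cube_point_le B_bernoulli B_indep _.
rewrite sumEFin lee_fin sumr_const -[leLHS]mulr_natl.
have Sn : (#|S| <= n)%N by rewrite -[leqRHS]card_ord max_card.
rewrite expfB_cond ?pnatr_eq0// mulrAC hoeffding_H_half//.
rewrite ler_pM2r ?invr_gt0 ?exprn_gt0//.
have s1 : 1 <= t / (n%:R - t) by rewrite ler_pdivlMr// mul1r; lra.
rewrite ler_pdivlMr ?powR_gt0 ?divr_gt0//.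
by have := card_heavy_points_le 'I_n t s1; rewrite card_ord.
Qed.
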